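(* (i) Let $\mathcal G$ be a periodic graph in $\mathbb R^d$ with fundamental graph $G_*=(\mathcal V_*,\mathcal E_* )$. Then the invariant $\mathcal I$ of $\mathcal G$ satisfies $$d\le\mathcal I\le\beta,\qquad \beta=\#\mathcal E_*-\#\mathcal V_*+1,$$ where $\beta$ is the Betti number of $G_*$. (ii) Let $\mathcal G$ be a periodic graph. Then for any integer $\mathrm n\in[0,\beta]$ there exists a magnetic potential $\alpha$ such that the invariant $\mathcal I_\alpha$ of the magnetic Laplacian $\Delta_\alpha$ on $\mathcal G$ equals $\mathrm n$. (iii) For any nonnegative integer $M$ and any positive integer $N$ there exist a periodic graph $\mathcal G$ and a magnetic potential $\alpha$ such that $$\beta-\mathcal I=M,\qquad \beta-\mathcal I_\alpha=N.$$ (iv) For any nonnegative integer $K$ there exist a periodic graph $\mathcal G$, a magnetic potential $\alpha$, and minimal forms $(\mathfrak m,\phi)\in\mathscr F(\kappa)\times\mathscr F(\alpha)$ such that $\beta-\mathcal I_{\mathfrak m,\phi}=K$.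
   Context: Periodic graphs. $\Gamma\subset\mathbb R^d$ is a lattice of rank $d$ with basis $a_1,\ldots,a_d$. For $x=\sum_s t_sa_s\in\mathbb R^d$ write $x_{\mathbb A}=(t_1,\ldots,t_d)$. A ($\Gamma$-)periodic graph $\mathcal G=(\mathcal V,\mathcal E)$ is a connected infinite locally finite graph (loops and multiple edges allowed) embedded in $\mathbb R^d$, with $\mathcal G+a=\mathcal G$ for all $a\in\Gamma$ and finite quotient graph $G_*=\mathcal G/\Gamma=(\mathcal V_*,\mathcal E_* )$, the fundamental graph. $\mathcal A$ and $\mathcal A_*$ are the sets of oriented edges of $\mathcal G$ and $G_*$ (each unoriented edge has two orientations); $\underline{\mathbf e}$ is the inverse of $\mathbf e$. The dimension $d$ and the lattice are part of the data of a periodic graph. A magnetic potential is $\alpha:\mathcal A\to\mathbb R$ with $\alpha(\underline{\mathbf e})=-\alpha(\mathbf e)$, $\alpha(\mathbf e+a)=\alpha(\mathbf e)$ for $a\in\Gamma$; the magnetic Laplacian is $(\Delta_\alpha f)(v)=\sum_{\mathbf e=(v,u)\in\mathcal A}(f(v)-e^{i\alpha(\mathbf e)}f(u))$ on $\ell^2(\mathcal V)$. Forms. A 1-form on a finite connected graph with oriented edge set $A$ is $\mathfrak b:A\to\mathbb R^n$ with $\mathfrak b(\underline{\mathbf e})=-\mathfrak b(\mathbf e)$. $\mathcal C$ is the (integral) cycle space, generated by closed edge paths. The flux is $\Phi_{\mathfrak b}(\mathbf c)=\sum_{\mathbf e\in\mathbf c}\mathfrak b(\mathbf e)$, $\mathbf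 c\in\mathcal C$. $\mathscr F(\mathbf x)$ is the set of 1-forms $\mathfrak b$ with $\Phi_{\mathfrak b}=\Phi_{\mathbf x}$. A form $\mathfrak m\in\mathscr F(\mathbf x)$ is minimal if $\#\operatorname{supp}\mathfrak m\le\#\operatorname{supp}\mathfrak b$ for all $\mathfrak b\in\mathscr F(\mathbf x)$. On $G_*$: the coordinate form $\kappa:\mathcal A_*\to\mathbb R^d$ is induced by $\kappa(\mathbf e)=v_{\mathbb A}-u_{\mathbb A}$ for $\mathbf e=(u,v)\in\mathcal A$; the magnetic form $\alpha:\mathcal A_*\to\mathbb R$ is induced by the potential $\alpha$. For the magnetic form fluxes are taken modulo $2\pi$: $\mathscr F(\alpha)$ is the set of real 1-forms on $G_*$ with the same fluxes as $\alpha$ modulo $2\pi$. For minimal forms $\mathfrak m\in\mathscr F(\kappa)$, $\phi\in\mathscr F(\alpha)$ put $\mathcal I=\frac12\#\operatorname{supp}\mathfrak m$, $\mathcal I_\alpha=\frac12\#\operatorname{supp}\phi$, $\mathcal I_{\mathfrak m,\phi}=\frac12\#(\operatorname{supp}\mathfrak m\cup\operatorname{supp}\phi)$; $\mathcal I$ and $\mathcal I_\alpha$ do not depend on the choice of minimal forms. *)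

(* Defs.v *)
From HB Require Import structures.
From mathcomp Require Import all_boot all_order all_algebra.
From mathcomp Require Import boolp classical_sets functions cardinality reals.
From mathcomp Require Import topology normedtype sequences exp trigo.

Set Implicit Arguments.
Unset Strict Implicit.
Unset Printing Implicit Defensive.

Import Order.TTheory GRing.Theory Num.Theory.

Local Open Scope classical_set_scope.
Local Open Scope ring_scope.

(* Graphs with loops and multiple edges. A dart is an oriented edge; every
   unoriented edge, a loop included, is a pair of distinct darts {e, drev e}. *)
Record mgraph := MGraph {
  vert : Type;
  dart : Type;
  src : dart -> vert;
  tgt : dart -> vert;
  drev : dart -> dart;
  drevK : involutive drev;
  drev_neq : forall e, drev e <> e;
  src_drev : forall e, src (drev e) = tgt e }.

Fixpoint walk (G : mgraph) (u : vert G) (p : seq (dart G)) (v : vert G) : Prop :=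
  if p is e :: p' then src e = u /\ walk (tgt e) p' v else u = v.

Definition connected_graph (G : mgraph) : Prop :=
  forall u v : vert G, exists p, walk u p v.

Definition locally_finite (G : mgraph) : Prop :=
  forall v : vert G, finite_set [set e : dart G | src e = v].

Record fgraph := FGraph {
  fvert : finType;
  fdart : finType;
  fsrc : fdart -> fvert;
  ftgt : fdart -> fvert;
  frev : fdart -> fdart;
  frevK : involutive frev;
  frev_neq : forall e, frev e <> e;
  fsrc_rev : forall e, fsrc (frev e) = ftgt e }.

Definition mgraph_of (G : fgraph) : mgraph :=
  MGraph (@frevK G) (@frev_neq G) (@fsrc_rev G).

Section FiniteGraph.
Variable G : fgraph.

Lemma even_rev_closed (S : {set fdart G}) :
  (forall e, (frev e \in S) = (e \in S)) -> ~~ odd #|S|.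
Proof.
have [n] := ubnP #|S|; elim: n S => // n IHn S leSn Srev.
have [->|[e Se]] := set_0Vmem S; first by rewrite cards0.
have Sre : frev e \in (S :\ e)%SET.
  by rewrite finset.in_setD1 Srev Se andbT; apply/eqP/frev_neq.
rewrite (cardsD1 e) Se (cardsD1 (frev e)) Sre /= negbK.
apply: IHn.
  by move: leSn; rewrite (cardsD1 e) Se (cardsD1 (frev e)) Sre => /ltnW.
move=> x; rewrite !finset.in_setD1 Srev (inj_eq (inv_inj (@frevK G))).
by rewrite (can2_eq (@frevK G) (@frevK G)) andbCA.
Qed.

Lemma even_dart : ~~ odd #|fdart G|.
Proof. by rewrite -cardsT; apply: even_rev_closed => e; rewrite !inE. Qed.

Definition num_edges : nat := #|fdart G|./2.

(* An integer, so that no truncated subtraction is involved. *)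
Definition betti : int := num_edges%:Z - #|fvert G|%:Z + 1.

(* Integral 1-chains are the functions c on darts with c (drev e) = - c e. *)
Definition chain (p : seq (fdart G)) : {ffun fdart G -> int} :=
  [ffun e => (count_mem e p)%:Z - (count_mem (frev e) p)%:Z].

Inductive cycle_space : {ffun fdart G -> int} -> Prop :=
| cycle_walk u p of @walk (mgraph_of G) u p u : cycle_space (chain p)
| cycle_sub c1 c2 of cycle_space c1 & cycle_space c2 : cycle_space (c1 - c2).

End FiniteGraph.

Section Forms.
Variables (R : realType) (G : fgraph) (U : lmodType R).
Implicit Types (b x m : fdart G -> U) (F : set (fdart G -> U)).

Definition one_form b : Prop := forall e, b (frev e) = - b e.

Definition supp b : {set fdart G} := [set e | b e != 0]%SET.

Lemma even_supp b : one_form b -> ~~ odd #|supp b|.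
Proof. by move=> bN; apply: even_rev_closed => e; rewrite !inE bN oppr_eq0. Qed.

(* The factor 1/2 compensates for summing over both orientations of each edge;
   see flux_chain. *)
Definition flux b (c : {ffun fdart G -> int}) : U :=
  2^-1 *: \sum_(e : fdart G) b e *~ c e.

Lemma flux_chain b p : one_form b -> flux b (chain p) = \sum_(e <- p) b e.
Proof.
move=> bN; rewrite /flux.
have cnt : \sum_(e : fdart G) b e *+ count_mem e p = \sum_(e <- p) b e.
  elim: p => [|x p IHp]; first by rewrite big_nil big1.
  rewrite big_cons -IHp /=.
  under eq_bigr do rewrite mulrnDr.
  rewrite big_split /= (bigD1 x) //= eqxx mulr1n big1 ?addr0 // => e ne.
  by rewrite eq_sym (negbTE ne).
have -> : \sum_(e : fdart G) b e *~ chain p e =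
          (\sum_(e <- p) b e) + \sum_(e <- p) b e.
  under eq_bigr do rewrite ffunE mulrzBr -!pmulrn.
  rewrite sumrB cnt [X in _ - X](reindex_inj (inv_inj (@frevK G))) /=.
  under [X in _ - X]eq_bigr do rewrite frevK bN mulNrn.
  by rewrite sumrN opprK cnt.
by rewrite -mulr2n -scaler_nat scalerA mulVf ?scale1r // pnatr_eq0.
Qed.

Definition same_flux x : set (fdart G -> U) :=
  [set b | one_form b /\ forall c, cycle_space c -> flux b c = flux x c].

Definition minimal F m : Prop :=
  F m /\ forall b, F b -> (#|supp m| <= #|supp b|)%N.

Lemma minimal_ex F : F !=set0 -> exists m, minimal F m.
Proof.
move=> [b0 Fb0].
have ex : exists n, `[< exists2 b, F b & #|supp b| = n >].
  by exists #|supp b0|; apply/asboolP; exists b0.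
case: (ex_minnP ex) => n /asboolP[m Fm <-] mmin.
by exists m; split => // b Fb; apply: mmin; apply/asboolP; exists b.
Qed.

Definition min_form F (F0 : F !=set0) : fdart G -> U :=
  projT1 (cid (minimal_ex F0)).

Lemma min_formP F (F0 : F !=set0) : minimal F (min_form F0).
Proof. exact: projT2 (cid (minimal_ex F0)). Qed.

Lemma minimal_card F m1 m2 :
  minimal F m1 -> minimal F m2 -> #|supp m1| = #|supp m2|.
Proof.
by move=> [F1 min1] [F2 min2]; apply/eqP; rewrite eqn_leq min1 ?min2.
Qed.

End Forms.

Definition same_flux_mod2pi (R : realType) (G : fgraph) (x : fdart G -> R) :
    set (fdart G -> R^o) :=
  [set b : fdart G -> R^o | one_form b /\
    forall c, cycle_space c ->
      exists k : int, flux b c = flux (x : fdart G -> R^o) c + k%:~R * (2 * pi)].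

(* The lattice basis a_1, ..., a_d is the family of rows of A, and
   Gamma = { lattice_point A n | n }. *)
Definition lattice_point (R : realType) (d : nat) (A : 'M[R]_d)
    (n : 'rV[int]_d) : 'rV[R]_d :=
  \sum_s (n 0 s)%:~R *: row s A.

Definition coords (R : realType) (d : nat) (A : 'M[R]_d) (x : 'rV[R]_d) :
  'rV[R]_d := x *m invmx A.

Lemma coordsE (R : realType) (d : nat) (A : 'M[R]_d) (x : 'rV[R]_d) :
  A \in unitmx -> x = \sum_s coords A x 0 s *: row s A.
Proof. by move=> uA; rewrite -mulmx_sum_row mulmxKV. Qed.

(* Vertices are points of R^d (pos is injective). The lattice Gamma, identified
   with Z^d through its basis, acts on vertices by translation of R^d and on
   darts by eshift n e, which is e + lattice_point n; parallel edges make the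
   action on darts separate data. The quotient G / Gamma is given by the finite
   graph fund and projections whose fibres are exactly the Gamma-orbits, which
   determines it up to a unique isomorphism. *)
Record periodic_graph (R : realType) (d : nat) := PeriodicGraph {
  period : 'M[R]_d;
  period_unit : period \in unitmx;
  graph :> mgraph;
  pos : vert graph -> 'rV[R]_d;
  pos_inj : injective pos;
  vshift : 'rV[int]_d -> vert graph -> vert graph;
  eshift : 'rV[int]_d -> dart graph -> dart graph;
  pos_vshift : forall n v, pos (vshift n v) = pos v + lattice_point period n;
  eshift0 : forall e, eshift 0 e = e;
  eshiftD : forall n n' e, eshift (n + n') e = eshift n (eshift n' e);
  src_eshift : forall n e, src (eshift n e) = vshift n (src e);
  rev_eshift : forall n e, drev (eshift n e) = eshift n (drev e);
  graph_connected : connected_graph graph;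
  graph_infinite : infinite_set [set: vert graph];
  graph_locally_finite : locally_finite graph;
  fund : fgraph;
  vproj : vert graph -> fvert fund;
  eproj : dart graph -> fdart fund;
  vproj_surj : forall x, exists v, vproj v = x;
  eproj_surj : forall x, exists e, eproj e = x;
  vproj_eq : forall u v, vproj u = vproj v <-> exists n, v = vshift n u;
  eproj_eq : forall e f, eproj e = eproj f <-> exists n, f = eshift n e;
  src_eproj : forall e, fsrc (eproj e) = vproj (src e);
  rev_eproj : forall e, frev (eproj e) = eproj (drev e) }.

Record magnetic_potential (R : realType) (d : nat) (G : periodic_graph R d) :=
  MagneticPotential {
    potential :> dart G -> R;
    potential_rev : forall e, potential (drev e) = - potential e;
    potential_eshift : forall n e, potential (eshift n e) = potential e }.

Section PeriodicGraph.
Variables (R : realType) (d : nat) (G : periodic_graph R d).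

(* The function induced on the darts of the fundamental graph by a periodic f;
   see descend_eproj. *)
Definition descend (U : Type) (f : dart G -> U) (x : fdart (fund G)) : U :=
  f (projT1 (cid (eproj_surj x))).

Lemma descend_eproj (U : Type) (f : dart G -> U) e :
  (forall n e, f (eshift n e) = f e) -> descend f (eproj e) = f e.
Proof.
move=> fper; rewrite /descend; case: cid => e' /= /eproj_eq[n ->]; by rewrite fper.
Qed.

Lemma one_form_descend (U : lmodType R) (f : dart G -> U) :
  (forall n e, f (eshift n e) = f e) -> (forall e, f (drev e) = - f e) ->
  one_form (descend f).
Proof.
move=> fper fN x; have [e <-] := eproj_surj x.
by rewrite rev_eproj !descend_eproj.
Qed.

Definition dart_coords (e : dart G) : 'rV[R]_d :=
  coords (period G) (pos (tgt e)) - coords (period G) (pos (src e)).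

Lemma tgt_eshift n (e : dart G) : tgt (eshift n e) = vshift n (tgt e).
Proof. by rewrite -!src_drev rev_eshift src_eshift. Qed.

Lemma dart_coords_eshift n (e : dart G) :
  dart_coords (eshift n e) = dart_coords e.
Proof.
rewrite /dart_coords tgt_eshift src_eshift !pos_vshift /coords !mulmxDl.
by rewrite opprD addrACA subrr addr0.
Qed.

Lemma dart_coords_rev (e : dart G) : dart_coords (drev e) = - dart_coords e.
Proof. by rewrite /dart_coords src_drev -[tgt (drev e)]src_drev drevK opprB. Qed.

Definition kappa : fdart (fund G) -> 'rV[R]_d := descend dart_coords.

Lemma same_flux_kappa_neq0 : same_flux kappa !=set0.
Proof.
exists kappa; split => //.
exact: one_form_descend dart_coords_eshift dart_coords_rev.
Qed.

Definition magnetic_form (alpha : magnetic_potential G) :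
  fdart (fund G) -> R^o := descend alpha.

Lemma same_flux_magnetic_neq0 (alpha : magnetic_potential G) :
  same_flux_mod2pi (magnetic_form alpha) !=set0.
Proof.
exists (magnetic_form alpha); split.
  apply: one_form_descend; [exact: potential_eshift|exact: potential_rev].
by move=> c _; exists 0; rewrite mul0r addr0.
Qed.

(* Supports of 1-forms have even cardinality (even_supp), so ./2 is exact, and
   the value is that of every minimal form (minimal_card). *)
Definition form_invariant : nat := #|supp (min_form same_flux_kappa_neq0)|./2.

Definition magnetic_invariant (alpha : magnetic_potential G) : nat :=
  #|supp (min_form (same_flux_magnetic_neq0 alpha))|./2.

Definition joint_invariant (m : fdart (fund G) -> 'rV[R]_d)
    (phi : fdart (fund G) -> R^o) : nat :=
  #|(supp m :|: supp phi)%SET|./2.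

End PeriodicGraph.

(* Main.v *)
Require Import Defs.
From mathcomp Require Import all_boot all_order all_algebra.
From mathcomp Require Import boolp classical_sets reals.
From mathcomp Require Import functions cardinality ereal trigo.
From mathcomp Require Import lebesgue_measure.

(** The two lower bounds come from one counting principle. Fix an orientation
    of every edge. The sum of a 1-form b along a closed walk is then an integer
    combination of the values of b on the positively oriented edges of its
    support, and there are #supp b / 2 of them; so this number bounds the rank
    of any family of fluxes of b.
    - For the coordinate form the fluxes contain the standard basis of R^d: a
      walk in the periodic graph from v to v + a_s projects to a closed walk of
      flux e_s. The rank over R gives d <= I ([rank_le_half_supp]).
    - For a magnetic form whose fluxes are numbers t_i that are linearly
      independent over Q together with pi, the rank is taken over Q modulo
      multiples of pi, so that passing to fluxes modulo 2 pi loses nothing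
      ([pi_rank_le_half_supp]). Such t_i exist since R is uncountable.

    The upper bound is the gauge along a spanning tree T: subtracting the
    coboundary of the sums along tree paths makes any 1-form vanish on T
    without changing its fluxes, and T misses exactly beta edges
    ([tree_gauge], [spanning_tree]). Conversely, a form that vanishes on T can
    take arbitrary values on the chords, and these are its fluxes through the
    fundamental cycles ([chord_cycle]); putting n of the independent numbers
    t_i on n chords gives a magnetic form of invariant n.

    The examples are the lattices Z^d with M loops attached to each vertex. Their
    quotient is a bouquet of d + M loops, so beta = d + M, while the coordinate
    form is supported by the d lattice directions and I = d. With d = N and a
    potential of invariant M this gives the third claim; with d = 1, M = K and
    zero potential, the fourth. *)

Set Implicit Arguments.
Unset Strict Implicit.
Unset Printing Implicit Defensive.

Import Order.TTheory GRing.Theory Num.Theory.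

Local Open Scope ring_scope.

(** * Walks *)

Section Walks.
Variable G : mgraph.

Lemma walk_cat (u v w : vert G) p q :
  walk u p v -> walk v q w -> walk u (p ++ q) w.
Proof.
by elim: p u => [u /= -> //|e p IHp u [eu pv] qw] /=; split=> //; exact: IHp.
Qed.

Lemma tgt_drev (e : dart G) : tgt (drev e) = src e.
Proof. by rewrite -src_drev drevK. Qed.

Lemma walk_rev (u v : vert G) p :
  walk u p v -> walk v (rev (map (@drev G) p)) u.
Proof.
elim: p u => [u /= -> //|e p IHp u [eu /IHp pv]].
rewrite /= rev_cons -cats1; apply: walk_cat pv _ => /=.
by rewrite src_drev tgt_drev.
Qed.

Lemma sum_walk (U : zmodType) (g : vert G -> U) u p v :
  walk u p v -> \sum_(e <- p) (g (tgt e) - g (src e)) = g v - g u.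
Proof.
elim: p u => [u /= ->|e p IHp u [<- /IHp pv]]; first by rewrite big_nil subrr.
by rewrite big_cons pv addrC addrA subrK.
Qed.

End Walks.

(** * Real numbers independent of pi over the rationals *)

Section RationalIndependence.
Variable R : realType.

(** A countable set is Lebesgue-null, whereas [0, 1] has measure 1. *)
Lemma countable_compl_neq0 (A : set R) : countable A -> exists x, ~ A x.
Proof.
move=> cA; apply/not_existsP => Aall.
have AT : A = setT.
  by apply/seteqP; split=> // x _; exact: contrapT (Aall x).
have := @lebesgue_measure_itv R `[0, 1].
rewrite /= lte_fin ltr01 oppr0 adde0 countable_lebesgue_measure0.
  by move/eqP; rewrite eqe eq_sym oner_eq0.
by rewrite AT in cA; apply: sub_countable cA; exact/subset_card_le/subsetT.
Qed.

(** Linear independence over Q in the quotient R / (Q pi); rational rather than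
    integral coefficients let it be applied to kernels of rational matrices. *)
Definition pi_independent (I : finType) (t : I -> R) : Prop :=
  forall (u : I -> rat) (q : rat),
    \sum_i ratr (u i) * t i = ratr q * pi -> forall i, u i = 0.

(** Inductively, the next number is taken outside the Q-span of pi and the
    previous ones, which is the range of a function on a countable type. *)
Lemma ex_pi_independent_nat n : exists t : nat -> R,
  pi_independent (fun i : 'I_n => t i).
Proof.
elim: n => [|n [t tI]]; first by exists (fun=> 0) => u q _ [].
pose F (z : rat * {ffun 'I_n -> rat}) : R :=
  ratr z.1 * pi + \sum_i ratr (z.2 i) * t i.
have [x xF] : exists x, ~ range F x.
  apply: countable_compl_neq0.
  exact: sub_countable (card_image_le _ _) (countableP _).
exists (fun i => if i == n then x else t i) => u q.
rewrite big_ord_recr /= eqxx.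
under eq_bigr => i _ do rewrite (ltn_eqF (ltn_ord i)).
have [un0|un0] := eqVneq (u ord_max) 0.
  rewrite un0 rmorph0 mul0r addr0 => /tI u0 i.
  have [j ->|->//] := unliftP ord_max i.
  by rewrite -(u0 j); congr u; apply/val_inj; rewrite /= /bump leqNgt ltn_ord.
move=> E; case: xF.
exists (q / u ord_max, [ffun i => - (u (widen_ord (leqnSn n) i) / u ord_max)]) => //.
have rn0 : ratr (u ord_max) != 0 :> R by rewrite fmorph_eq0.
apply: (mulfI rn0); rewrite /F /= mulrDr mulrA -rmorphM mulrCA mulfV // mulr1.
rewrite -E addrAC mulr_sumr -big_split /= big1 ?add0r // => i _.
rewrite ffunE mulrA -rmorphM mulrN mulrCA mulfV // mulr1 rmorphN mulNr.
exact: subrr.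
Qed.

Lemma ex_pi_independent (I : finType) : exists t : I -> R, pi_independent t.
Proof.
have [t tI] := ex_pi_independent_nat #|I|.
exists (fun i => t (enum_rank i)) => u q E i; rewrite -[i]enum_rankK.
apply: (tI (u \o enum_val) q); rewrite -E [RHS](reindex _ (onW_bij _ (@enum_val_bij I))).
by apply: eq_bigr => j _; rewrite /= enum_valK.
Qed.

End RationalIndependence.

(** * Fluxes and ranks on finite graphs *)

Section FiniteGraphs.
Variable G : Defs.fgraph.
Implicit Types S : {set fdart G}.

(** An arbitrary orientation of the edges, taken from an enumeration of the
    darts; reversal has no fixed points, so each edge has exactly one positive
    dart. *)
Definition positive_darts : {set fdart G} :=
  [set e | (enum_rank e < enum_rank (frev e))%N]%SET.

Lemma positive_darts_rev (e : fdart G) :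
  (frev e \in positive_darts) = (e \notin positive_darts).
Proof.
rewrite !inE frevK -leqNgt [RHS]leq_eqVlt; case: eqP => //= E.
by have /frev_neq := enum_rank_inj (val_inj E).
Qed.

Lemma card_positive S : (forall e, (frev e \in S) = (e \in S)) ->
  #|S| = #|S :&: positive_darts|.*2.
Proof.
move=> Srev; rewrite -(cardsID positive_darts S) -addnn; congr (_ + _)%N.
rewrite -[RHS](card_imset _ (inv_inj (@frevK G))); apply: eq_card => e.
apply/idP/imsetP=> [|[f]].
  rewrite !finset.inE => /andP[eP eS]; exists (frev e); last by rewrite frevK.
  by rewrite finset.in_setI Srev eS positive_darts_rev finset.inE.
by rewrite finset.in_setI => /andP[fS fP] ->;
  rewrite finset.in_setD Srev fS andbT positive_darts_rev negbK.
Qed.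

Section Flux.
Variables (R : realType) (U : lmodType R).
Implicit Types b : fdart G -> U.

Lemma fluxB b c1 c2 : flux b (c1 - c2) = flux b c1 - flux b c2.
Proof.
rewrite /flux -scalerBr -sumrB; congr (_ *: _); apply: eq_bigr => e _.
by rewrite !ffunE mulrzBr.
Qed.

(** A coboundary telescopes to zero along every closed walk. *)
Lemma gauge_same_flux b (g : fvert G -> U) : one_form b ->
  same_flux b (fun e => b e + (g (fsrc e) - g (ftgt e))).
Proof.
move=> bN.
have b'N : one_form (fun e => b e + (g (fsrc e) - g (ftgt e))).
  move=> e; rewrite bN fsrc_rev -[ftgt (frev e)]fsrc_rev frevK.
  by rewrite opprD opprB.
split=> // c; elim=> [u p pw|c1 c2 _ E1 _ E2]; last by rewrite !fluxB E1 E2.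
rewrite !flux_chain // big_split /= -[RHS]addr0; congr (_ + _).
rewrite -[LHS]opprK -sumrN; apply/eqP; rewrite oppr_eq0; apply/eqP.
rewrite -[RHS](subrr (g u)) -(@sum_walk (mgraph_of G) _ g _ _ _ pw).
by apply: eq_bigr => e _; rewrite opprB.
Qed.

Lemma supp_rev b : one_form b -> forall e, (frev e \in supp b) = (e \in supp b).
Proof. by move=> bN e; rewrite !inE bN oppr_eq0. Qed.

Lemma half_card_supp b : one_form b ->
  #|supp b|./2 = #|supp b :&: positive_darts|.
Proof. by move=> bN; rewrite (card_positive (supp_rev bN)) doubleK. Qed.

(** The two darts of an edge contribute equally to the flux, because both the
    form and the chain change sign under reversal; hence #|supp b|./2 terms
    suffice. *)
Lemma sum_positive b p : one_form b ->
  \sum_(e <- p) b e =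
  \sum_(e in supp b :&: positive_darts) b e *~ chain p e.
Proof.
move=> bN; rewrite -flux_chain // /flux (bigID (mem positive_darts)) /=.
rewrite [X in _ + X](reindex_inj (inv_inj (@frevK G))) /=.
have -> : \sum_(e | frev e \notin positive_darts) b (frev e) *~ chain p (frev e)
          = \sum_(e in positive_darts) b e *~ chain p e.
  apply: eq_big => [e|e _]; first by rewrite positive_darts_rev negbK.
  by rewrite bN !ffunE frevK -opprB mulrNz mulNrz opprK.
rewrite -mulr2n -[X in _ *: X]scaler_nat scalerA mulVf ?scale1r ?pnatr_eq0 //.
rewrite (bigID (mem (supp b))) /= addrC big1 ?add0r => [|e /andP[_]].
  by apply: eq_bigl => e; rewrite finset.in_setI andbC.
by rewrite finset.inE negbK => /eqP ->; rewrite mul0rz.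
Qed.

End Flux.

(** The identity matrix factors through the space indexed by the positive darts
    of the support. *)
Lemma rank_le_half_supp (R : realType) d (b : fdart G -> 'rV[R]_d)
    (p : 'I_d -> seq (fdart G)) :
  one_form b -> (forall s, \sum_(e <- p s) b e = delta_mx 0 s) ->
  (d <= #|supp b|./2)%N.
Proof.
move=> bN pE; rewrite half_card_supp //; set H := _ :&: _.
(* C has the multiplicities of the darts in the walks, B the values of b. *)
pose C : 'M[R]_(d, #|H|) := \matrix_(s, i) (chain (p s) (enum_val i))%:~R.
pose B : 'M[R]_(#|H|, d) := \matrix_i b (enum_val i).
have CB : C *m B = 1%:M.
  apply/row_matrixP => s; rewrite row1 -pE sum_positive // -/H big_enum_val.
  rewrite row_mul mulmx_sum_row; apply: eq_bigr => i _.
  by rewrite rowK !mxE scaler_int.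
by rewrite -(@mxrank1 R d) -CB (leq_trans (mxrankM_maxr _ _)) ?rank_leq_row.
Qed.

(** If the positive darts of the support were fewer than the walks, some
    nontrivial rational combination of the chains of the walks would vanish on
    the support. The same combination of the fluxes is then zero, which is a
    rational relation between the t i and pi. *)
Lemma pi_rank_le_half_supp (R : realType) (I : finType) (t : I -> R)
    (b : fdart G -> R^o) (p : I -> seq (fdart G)) :
  pi_independent t -> one_form b ->
  (forall i, exists k : int, \sum_(e <- p i) b e = t i + k%:~R * (2 * pi)) ->
  (#|I| <= #|supp b|./2)%N.
Proof.
move=> tI bN /choice[k pE]; rewrite half_card_supp //; set H := _ :&: _.
rewrite leqNgt; apply/negP => ltHI.
pose C : 'M[rat]_(#|I|, #|H|) :=
  \matrix_(i, j) (chain (p (enum_val i)) (enum_val j))%:~R.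
have : kermx C != 0.
  by rewrite kermx_eq0 /row_free neq_ltn (leq_ltn_trans (rank_leq_col C)).
case/rowV0Pn=> u /sub_kermxP uC /eqP; apply; apply/rowP => i; rewrite mxE.
have := tI (fun i => u 0 (enum_rank i))
  (- \sum_i u 0 (enum_rank i) * (k i)%:~R * 2) _ (enum_val i).
rewrite enum_valK; apply.
have: \sum_i ratr (u 0 (enum_rank i)) * (\sum_(e <- p i) b e) = 0 :> R.
  under eq_bigr => j _ do rewrite sum_positive // -/H mulr_sumr.
  rewrite exchange_big /= big1 // => e eH.
  transitivity (b e * ratr ((u *m C) 0 (enum_rank_in eH e))).
    rewrite mxE rmorph_sum mulr_sumr /= [LHS](reindex _ (onW_bij _ (@enum_val_bij I))).
    apply: eq_bigr => j _; rewrite enum_valK !mxE enum_rankK_in // rmorphM /=.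
    by rewrite ratr_int mulrCA -mulrzr mulrA.
  by rewrite uC mxE rmorph0 mulr0.
under eq_bigr => j _ do rewrite pE mulrDr.
rewrite big_split /= => /eqP; rewrite addr_eq0 => /eqP ->.
rewrite rmorphN mulNr rmorph_sum mulr_suml; congr (- _); apply: eq_bigr => j _.
by rewrite !rmorphM /= ratr_int ratr_nat !mulrA.
Qed.

End FiniteGraphs.

(** * Spanning trees *)

Section SpanningTree.
Variables (G : Defs.fgraph) (r : fvert G).
Hypothesis Gconn : connected_graph (mgraph_of G).
Implicit Types (T : {set fdart G}) (W : {set fvert G}).

(** A tree T on the vertex set W together with the tree paths P from the root r.
    The last clause says that each dart of T joins a vertex to its parent; it
    replaces acyclicity, and is what makes sums along the paths P telescope. *)
Definition rooted_tree (W : {set fvert G}) (T : {set fdart G})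
    (P : fvert G -> seq (fdart G)) : Prop :=
  [/\ r \in W,
      forall e, (frev e \in T) = (e \in T),
      forall e, e \in T -> fsrc e \in W,
      forall v, v \in W -> @walk (mgraph_of G) r (P v) v /\ {subset P v <= T} &
      forall e, e \in T ->
        P (ftgt e) = rcons (P (fsrc e)) e \/
        P (fsrc e) = rcons (P (ftgt e)) (frev e)].

Lemma ftgt_rev (e : fdart G) : ftgt (frev e) = fsrc e.
Proof. exact: (@tgt_drev (mgraph_of G)). Qed.

Lemma exit_dart W u p v : @walk (mgraph_of G) u p v -> u \in W -> v \notin W ->
  exists e : fdart G, fsrc e \in W /\ ftgt e \notin W.
Proof.
elim: p u => [u /= -> uW /negP//|e p IHp u /= [<- pv] eW vW].
by case: (boolP (ftgt e \in W)) => [teW|]; [exact: IHp pv teW vW|exists e].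
Qed.

(** By connectedness a walk leaves W as long as W is not everything; the first
    dart that does so extends the tree by one edge and one vertex. *)
Lemma tree_growth k : (k < #|fvert G|)%N ->
  exists W T P, [/\ rooted_tree W T P, #|W| = k.+1 & #|T| = k.*2].
Proof.
elim: k => [_|k IHk ltk].
  exists [set r]%SET, finset.set0, (fun=> [::]).
  split; rewrite ?cards1 ?cards0 //.
  split=> [|e|e|v|e]; rewrite ?finset.inE //.
  by move=> /eqP ->.
have [W [T [P [[rW Trev Tsrc Pw Pe] cW cT]]]] := IHk (ltnW ltk).
have [v vW] : exists v, v \notin W.
  apply/existsP; rewrite -negb_forall; apply: contraL ltk => /forallP Wall.
  by rewrite -cW -leqNgt; apply/subset_leq_card/fintype.subsetP=> v _.
have [p pv] := Gconn r v.
have [e [eW teW]] := exit_dart pv rW vW.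
have eT : e \notin T.
  by apply: contra teW; rewrite -Trev => /Tsrc; rewrite fsrc_rev.
have Ttgt f : f \in T -> ftgt f \in W.
  by rewrite -Trev => /Tsrc; rewrite fsrc_rev.
have neW u : u \in W -> (u == ftgt e) = false.
  by move=> uW; apply/eqP => E; rewrite -E uW in teW.
exists (ftgt e |: W)%SET, (e |: (frev e |: T))%SET.
exists (fun v => if v == ftgt e then rcons (P (fsrc e)) e else P v).
split; first split.
- by rewrite finset.in_setU1 rW orbT.
- move=> f; rewrite !finset.in_setU1 Trev (inj_eq (inv_inj (@frevK G))).
  by rewrite (can2_eq (@frevK G) (@frevK G)) orbCA.
- move=> f; rewrite !finset.in_setU1 => /or3P[/eqP->|/eqP->|/Tsrc ->].
  + by rewrite eW orbT.
  + by rewrite fsrc_rev eqxx.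
  + by rewrite orbT.
- move=> u; rewrite finset.in_setU1; case: eqP => [-> _|_ /= uW].
    have [ew es] := Pw _ eW; split.
      by rewrite -cats1; apply: walk_cat ew _.
    move=> f; rewrite mem_rcons seq.in_cons !finset.in_setU1.
    by case: eqP => //= _ /es ->; rewrite orbT.
  have [uw us] := Pw _ uW; split=> // f /us.
  by rewrite !finset.in_setU1 => ->; rewrite !orbT.
- move=> f; rewrite !finset.in_setU1 => /or3P[/eqP->|/eqP->|fT].
  + by left; rewrite eqxx neW.
  + by right; rewrite ftgt_rev fsrc_rev eqxx neW // frevK.
  + by rewrite !neW ?Ttgt ?Tsrc //; exact: Pe.
- by rewrite cardsU1 teW cW.
- rewrite cardsU1 cardsU1 Trev eT finset.in_setU1 (negbTE eT) orbF.
  rewrite eq_sym; have /eqP/negbTE-> := @frev_neq G e.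
  by rewrite cT doubleS.
Qed.

Lemma spanning_tree : exists T P,
  rooted_tree [set: fvert G]%SET T P /\ (#|~: T|./2)%:Z = betti G.
Proof.
have V0 : (0 < #|fvert G|)%N by apply/card_gt0P; exists r.
have lt : (#|fvert G|.-1 < #|fvert G|)%N by rewrite prednK.
have [W [T [P [tree cW cT]]]] := tree_growth lt.
have WT : W = [set: fvert G]%SET.
  by apply/eqP; rewrite eqEcard finset.subsetT cardsT cW prednK /=.
exists T, P; rewrite -WT; split=> //.
rewrite /betti /num_edges -(cardsC T) cT halfD doubleK odd_double /= add0n.
rewrite PoszD; have -> : (#|fvert G|%:Z = #|fvert G|.-1%:Z + 1).
  by rewrite -PoszD addn1 prednK.
by rewrite opprD addrA addrNK addrAC subrr add0r.
Qed.

(** The potential at v is the sum of b along the tree path to v: along a tree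
    dart it increases by exactly the value of b, which cancels it. *)
Lemma tree_gauge T P (R : realType) (U : lmodType R) (b : fdart G -> U) :
  rooted_tree [set: fvert G]%SET T P -> one_form b ->
  exists2 m, same_flux b m & supp m \subset ~: T.
Proof.
case=> _ _ _ _ Pe bN.
exists (fun e => b e + (\sum_(f <- P (fsrc e)) b f - \sum_(f <- P (ftgt e)) b f)).
  exact: (gauge_same_flux (fun v => \sum_(f <- P v) b f)).
apply/fintype.subsetP => e; rewrite finset.in_setC; apply: contraTN => /Pe.
rewrite finset.inE negbK; case=> ->; rewrite -cats1 big_cat big_seq1 /=.
  by rewrite opprD [X in _ + X]addrA subrr sub0r subrr.
by rewrite bN addrAC subrr sub0r subrr.
Qed.

(** The fundamental cycle of e: down the tree to the source of e, across e, and
    back to the root along the reversed tree path. *)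
Lemma chord_cycle T P (U : zmodType) (a : fdart G -> U) e :
  rooted_tree [set: fvert G]%SET T P -> {in T, forall f, a f = 0} ->
  exists p, @walk (mgraph_of G) r p r /\ \sum_(f <- p) a f = a e.
Proof.
case=> _ Trev _ Pw _ aT.
have [sw sT] := Pw (fsrc e) (finset.in_setT _).
have [tw tT] := Pw (ftgt e) (finset.in_setT _).
exists (P (fsrc e) ++ e :: rev (map (@frev G) (P (ftgt e)))); split.
  by apply: walk_cat sw _; split=> //; exact: (walk_rev tw).
have a0 p : {subset p <= T} -> \sum_(f <- p) a f = 0.
  by move=> pT; rewrite big_seq big1 // => f /pT/aT.
rewrite big_cat big_cons /= !a0 ?addr0 ?add0r // => f.
by rewrite mem_rev => /mapP[g /tT gT ->]; rewrite Trev.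
Qed.

Lemma same_flux_upper (R : realType) (U : lmodType R) (b : fdart G -> U) :
  one_form b -> exists2 m, same_flux b m & (#|supp m|./2)%:Z <= betti G.
Proof.
move=> bN; have [T [P [tree <-]]] := spanning_tree.
have [m bm mT] := tree_gauge tree bN; exists m => //.
by rewrite lez_nat half_leq // subset_leq_card.
Qed.

(** The form carries Q-independent numbers t on n positive chords and vanishes
    on all other edges. The fundamental cycles of these chords have fluxes t, so
    any form with the same fluxes modulo 2 pi is supported on n edges or
    more. *)
Lemma ex_form_mod2pi (R : realType) (n : nat) : n%:Z <= betti G ->
  exists a : fdart G -> R^o, [/\ one_form a, (#|supp a|./2 <= n)%N &
    forall b, same_flux_mod2pi a b -> (n <= #|supp b|./2)%N].
Proof.
have [T [P [tree <-]]] := spanning_tree.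
have [_ Trev _ _ _] := tree.
have Crev e : (frev e \in ~: T) = (e \in ~: T) by rewrite !finset.in_setC Trev.
rewrite (card_positive Crev) doubleK lez_nat => leH.
(* H is a set of n chords, each represented by its positive dart. *)
have [H HC cH] : exists2 H : {set fdart G}, H \subset ~: T :&: positive_darts G & #|H| = n.
  exists [set:: take n (enum (~: T :&: positive_darts G))]%SET.
    apply/fintype.subsetP => e; rewrite finset.inE => /mem_take.
    by rewrite mem_enum.
  rewrite finset.cardsE (card_uniqP _) ?take_uniq ?enum_uniq //.
  by rewrite size_takel // -cardE.
have [t tI] := ex_pi_independent R {e | e \in H}.
pose a0 e := if insub e is Some i then t i else 0.
have a0E i : a0 (val i) = t i by rewrite /a0 valK.
have a00 e : e \notin H -> a0 e = 0 by move=> eH; rewrite /a0 insubN.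
(* At most one of e and frev e is in H, so one of the two terms is 0. *)
pose a e : R^o := a0 e - a0 (frev e).
have Hpos e : e \in H -> (e \notin T) && (e \in positive_darts G).
  by move/(fintype.subsetP HC); rewrite finset.in_setI finset.in_setC.
have aN : one_form a by move=> e; rewrite /a frevK opprB.
exists a; split=> // [|b [bN bE]].
  rewrite half_card_supp // -cH subset_leq_card //.
  apply/fintype.subsetP => e; rewrite finset.in_setI finset.inE => /andP[ae eP].
  apply: contraNT ae => eH; rewrite /a !a00 ?subrr //.
  by apply/negP => /Hpos/andP[_]; rewrite positive_darts_rev eP.
have aT : {in T, forall f, a f = 0}.
  move=> f fT; rewrite /a !a00 ?subrr //.
    by apply/negP => /Hpos; rewrite Trev fT.
  by apply/negP => /Hpos; rewrite fT.
have [p pE] := choice (fun i : {e | e \in H} => chord_cycle (val i) tree aT).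
rewrite -cH -card_sig; apply: (pi_rank_le_half_supp (p := p) tI bN) => i.
have [pw pa] := pE i; have [k bk] := bE _ (cycle_walk pw); exists k.
rewrite -flux_chain // bk flux_chain // pa /a a0E a00 ?subr0 //.
have /Hpos/andP[_ iP] := valP i.
by apply/negP => /Hpos/andP[_]; rewrite positive_darts_rev iP.
Qed.

End SpanningTree.

(** * Invariants of periodic graphs *)

Section PeriodicGraphs.
Variables (R : realType) (d : nat) (G : periodic_graph R d).

Lemma lattice_pointE (A : 'M[R]_d) (n : 'rV[int]_d) :
  lattice_point A n = map_mx intr n *m A.
Proof. by rewrite mulmx_sum_row; apply: eq_bigr => s _; rewrite mxE. Qed.

Lemma tgt_eproj (e : dart G) : ftgt (eproj e) = vproj (tgt e).
Proof. by rewrite -fsrc_rev rev_eproj src_eproj src_drev. Qed.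

Lemma walk_proj (u v : vert G) p : walk u p v ->
  @walk (mgraph_of (fund G)) (vproj u) (map (@eproj R d G) p) (vproj v).
Proof.
elim: p u => [u /= -> //|e p IHp u /= [<- /IHp pv]].
by rewrite src_eproj tgt_eproj.
Qed.

Lemma fund_connected : connected_graph (mgraph_of (fund G)).
Proof.
move=> x y; have [u <-] := vproj_surj x; have [v <-] := vproj_surj y.
have [p pw] := graph_connected u v; exists (map (@eproj R d G) p).
exact: walk_proj.
Qed.

Lemma ex_vert : exists v : vert G, True.
Proof.
apply: contrapT => noV; apply: (@graph_infinite R d G).
have -> : [set: vert G]%classic = classical_sets.set0 by apply/seteqP; split=> v // _; case: noV; exists v.
exact: finite_set0.
Qed.

Lemma kappa_one_form : one_form (kappa (G := G)).
Proof. exact: one_form_descend (@dart_coords_eshift R d G) (@dart_coords_rev R d G). Qed.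

(** A walk from v to its translate by the lattice basis vector a_s closes up in
    the quotient, and the coordinate differences along it telescope to e_s. *)
Lemma kappa_cycle (s : 'I_d) : exists u p,
  @walk (mgraph_of (fund G)) u p u /\ \sum_(e <- p) kappa e = delta_mx 0 s.
Proof.
have [v _] := ex_vert; have [p pw] := graph_connected v (vshift (delta_mx 0 s) v).
exists (vproj v), (map (@eproj R d G) p); split.
  have {2}-> : vproj v = vproj (vshift (delta_mx 0 s) v).
    by apply/vproj_eq; exists (delta_mx 0 s).
  exact: walk_proj.
rewrite big_map; under eq_bigr => e _.
  rewrite /kappa descend_eproj; last exact: dart_coords_eshift.
  over.
rewrite (sum_walk (fun v => coords (period G) (pos v)) pw) pos_vshift.
rewrite /coords mulmxDl addrC addKr lattice_pointE mulmxK ?period_unit //.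
by apply/rowP => i; rewrite !mxE mulrz_nat.
Qed.

Lemma same_flux_kappa_lower (b : fdart (fund G) -> 'rV[R]_d) :
  same_flux (kappa (G := G)) b -> (d <= #|supp b|./2)%N.
Proof.
move=> [bN bE].
have /choice[p pE] : forall s : 'I_d, exists p, \sum_(e <- p) b e = delta_mx 0 s.
  move=> s; have [u [p [pw ps]]] := kappa_cycle s; exists p.
  rewrite -ps -!flux_chain //; last exact: kappa_one_form.
  exact: bE (cycle_walk pw).
exact: rank_le_half_supp bN pE.
Qed.

Lemma form_invariant_min (m : fdart (fund G) -> 'rV[R]_d) :
  same_flux (kappa (G := G)) m -> (form_invariant G <= #|supp m|./2)%N.
Proof.
move=> Fm; apply: half_leq.
by have [_] := min_formP (@same_flux_kappa_neq0 R d G); apply.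
Qed.

Lemma form_invariant_bounds :
  (d <= form_invariant G)%N /\ (form_invariant G)%:Z <= betti (fund G).
Proof.
split.
  apply: same_flux_kappa_lower.
  by have [] := min_formP (@same_flux_kappa_neq0 R d G).
have [v _] := ex_vert.
have [m Fm mB] := same_flux_upper (vproj v) fund_connected kappa_one_form.
by apply: le_trans mB; rewrite lez_nat form_invariant_min.
Qed.

Section Lift.
Variables (a : fdart (fund G) -> R) (aN : one_form (a : _ -> R^o)).

Lemma lift_rev (e : dart G) : a (eproj (drev e)) = - a (eproj e).
Proof. by rewrite -rev_eproj aN. Qed.

Lemma lift_eshift n (e : dart G) : a (eproj (eshift n e)) = a (eproj e).
Proof. by congr a; apply/esym/eproj_eq; exists n. Qed.

Definition lift_potential : magnetic_potential G :=
  MagneticPotential lift_rev lift_eshift.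

Lemma lift_potentialK : magnetic_form lift_potential = a.
Proof.
apply/funext => x; have [e <-] := eproj_surj x.
exact: (descend_eproj e lift_eshift).
Qed.

End Lift.

(** Every 1-form on the quotient is the magnetic form of its pull-back, so it
    suffices to choose the form on the quotient. *)
Lemma ex_magnetic_invariant (n : int) : 0 <= n <= betti (fund G) ->
  exists alpha : magnetic_potential G, (magnetic_invariant alpha)%:Z = n.
Proof.
case: n => // n /= leb; have [v _] := ex_vert.
have [a [aN aU aL]] := ex_form_mod2pi (vproj v) fund_connected R leb.
exists (lift_potential aN); congr Posz; rewrite /magnetic_invariant.
have := min_formP (same_flux_magnetic_neq0 (lift_potential aN)).
move: (min_form _) => m; rewrite lift_potentialK => -[Fm minm].
apply/eqP; rewrite eqn_leq; apply/andP; split; last first.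
  exact: aL.
apply: leq_trans aU; apply/half_leq/minm.
by split=> // c _; exists 0; rewrite mul0r addr0.
Qed.

End PeriodicGraphs.

(** * The integer lattice with extra loops *)

Section Bouquet.
Variables (R : realType) (d M : nat).

Let label := ('I_d.+1 + 'I_M)%type.
Let cell := 'rV[int]_d.+1.

(** The edges at each vertex are labelled by the lattice directions [inl s] and
    by the loops [inr j]. *)
Definition step (l : label) : cell := if l is inl s then delta_mx 0 s else 0.

(** The dart (v, l, false) goes from v to v + step l, and (v, l, true) is its
    reverse: the vertex component names the edge, not the source of the
    dart. *)
Definition tail (e : cell * label * bool) : cell :=
  let: (v, l, b) := e in if b then v + step l else v.
Definition flip (e : cell * label * bool) : cell * label * bool :=
  let: (v, l, b) := e in (v, l, ~~ b).
Definition head (e : cell * label * bool) : cell := tail (flip e).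

Lemma flipK : involutive flip.
Proof. by case=> [[v l] b]; rewrite /= negbK. Qed.

Lemma flip_neq e : flip e <> e.
Proof. by case: e => [[v l] []]. Qed.

Definition grid : mgraph :=
  @MGraph cell (cell * label * bool)%type tail head flip flipK flip_neq (fun=> erefl).

Definition bouquet_rev (e : label * bool) := (e.1, ~~ e.2).

Lemma bouquet_revK : involutive bouquet_rev.
Proof. by case=> l b; rewrite /bouquet_rev negbK. Qed.

Lemma bouquet_rev_neq e : bouquet_rev e <> e.
Proof. by case: e => l []. Qed.

Definition bouquet : Defs.fgraph :=
  @FGraph unit (label * bool)%type (fun=> tt) (fun=> tt) bouquet_rev
    bouquet_revK bouquet_rev_neq (fun=> erefl).

Definition point (v : cell) : 'rV[R]_d.+1 := map_mx intr v.
Definition shift (n : cell) (e : cell * label * bool) :=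
  let: (v, l, b) := e in (v + n, l, b).
Definition forget (e : cell * label * bool) : label * bool :=
  let: (v, l, b) := e in (l, b).

Lemma point_inj : injective point.
Proof.
by move=> u v /rowP uv; apply/rowP => i; have := uv i; rewrite !mxE => /intr_inj.
Qed.

Lemma grid_connected : connected_graph grid.
Proof.
pose reach n := forall u, exists p, @walk grid u p (u + n).
have r0 : reach 0 by move=> u; exists [::]; rewrite /= addr0.
have rD m n : reach m -> reach n -> reach (m + n).
  move=> rm rn u; have [p pw] := rm u; have [q qw] := rn (u + m).
  by exists (p ++ q); rewrite addrA; exact: walk_cat pw qw.
have rN n : reach n -> reach (- n).
  move=> rn u; have [p pw] := rn (u - n); rewrite subrK in pw.
  by eexists; exact: walk_rev pw.
have rs s : reach (delta_mx 0 s).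
  by move=> u; exists [:: (u, inl s, false)].
have rM n s : reach (delta_mx 0 s *+ n) by elim: n => // n; rewrite mulrS; exact: rD.
move=> u v; rewrite -[v](subrK u) [v - u + u]addrC; apply: (_ : reach _).
rewrite (row_sum_delta (v - u)); apply: big_ind => // s _.
rewrite -[_ 0 s]intz scaler_int; case: ((v - u) 0 s) => n; first exact: rM.
by rewrite NegzE mulrNz; exact/rN/rM.
Qed.

Lemma grid_infinite : infinite_set [set: vert grid]%classic.
Proof.
pose f (n : nat) : vert grid := const_mx n%:Z.
move=> /(@finite_preimage _ _ _ f) fin; apply: infinite_nat; apply: fin.
by move=> m n _ _ /rowP/(_ ord0); rewrite !mxE => -[].
Qed.

Lemma grid_locally_finite : locally_finite grid.
Proof.
move=> v; pose f (e : label * bool) : dart grid :=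
  (if e.2 then v - step e.1 else v, e.1, e.2).
apply: (@sub_finite_set _ _ [set f e | e in setT]%classic).
  move=> [[u l] b] uv; have {}uv : (if b then u + step l else u) = v := uv.
  by exists (l, b); rewrite // /f -uv; case: b {uv}; rewrite ?addrK.
exact/finite_image/finite_finset.
Qed.

Lemma point_shift (n v : cell) :
  point (v + n) = point v + lattice_point 1%:M n.
Proof. by rewrite lattice_pointE mulmx1 /point map_mxD. Qed.

Lemma shift0 e : shift 0 e = e.
Proof. by case: e => [[v l] b]; rewrite /= addr0. Qed.

Lemma shiftD n n' e : shift (n + n') e = shift n (shift n' e).
Proof. by case: e => [[v l] b]; rewrite /= [n + n']addrC addrA. Qed.

Lemma tail_shift n e : tail (shift n e) = tail e + n.
Proof. by case: e => [[v l] []] //=; rewrite addrAC. Qed.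

Lemma flip_shift n e : flip (shift n e) = shift n (flip e).
Proof. by case: e => [[v l] b]. Qed.

Lemma forget_eq e f : forget e = forget f <-> exists n, f = shift n e.
Proof.
case: e f => [[u l] b] [[v l'] b'] /=; split=> [[-> ->]|[n [_ -> ->]]//].
by exists (v - u); rewrite addrC subrK.
Qed.

Lemma forget_surj x : exists e, forget e = x.
Proof. by case: x => l b; exists (0, l, b). Qed.

Lemma forget_rev e : bouquet_rev (forget e) = forget (flip e).
Proof. by case: e => [[v l] b]. Qed.

Definition bouquet_cover : periodic_graph R d.+1.
Proof.
refine (@PeriodicGraph R d.+1 1%:M (unitmx1 _ _) grid point point_inj
  (fun n v => v + n) shift point_shift shift0 shiftD tail_shift flip_shift
  grid_connected grid_infinite grid_locally_finite bouquet (fun=> tt) forget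
  _ forget_surj _ forget_eq (fun=> erefl) forget_rev).
- by case; exists 0.
- by move=> u v; split=> // _; exists (v - u); rewrite addrC subrK.
Defined.

Lemma betti_bouquet : betti (fund bouquet_cover) = (d.+1 + M)%N%:Z.
Proof.
rewrite /betti /num_edges /= card_prod card_sum !card_ord card_bool muln2 doubleK.
by rewrite card_unit subrK.
Qed.

(** The coordinate form vanishes on the loops. *)
Lemma half_supp_kappa : (#|supp (kappa (G := bouquet_cover))|./2 <= d.+1)%N.
Proof.
rewrite -[leqRHS]doubleK half_leq //.
have -> : d.+1.*2 = #|{: 'I_d.+1 * bool}|.
  by rewrite card_prod card_ord card_bool muln2.
pose f (x : 'I_d.+1 * bool) : fdart (fund bouquet_cover) := (inl x.1, x.2).
rewrite -cardsT (leq_trans _ (leq_imset_card f _)) // subset_leq_card //.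
apply/fintype.subsetP => -[[s|j] b]; first by move=> _; apply/imsetP; exists (s, b).
have -> : (inr j, b) = eproj (p := bouquet_cover) (0, inr j, b) by [].
rewrite finset.inE /kappa descend_eproj; last exact: dart_coords_eshift.
by rewrite /dart_coords /=; case: b; rewrite /head /= addr0 subrr eqxx.
Qed.

Lemma form_invariant_bouquet : form_invariant bouquet_cover = d.+1.
Proof.
have [dI _] := form_invariant_bounds bouquet_cover.
apply/eqP; rewrite eqn_leq dI andbT (leq_trans _ half_supp_kappa) //.
by apply: form_invariant_min; split=> //; exact: kappa_one_form.
Qed.

Lemma kappa_minimal_bouquet : minimal (same_flux (kappa (G := bouquet_cover)))
  (kappa (G := bouquet_cover)).
Proof.
split=> [|b Fb]; first by split=> //; exact: kappa_one_form.
have [bN _] := Fb.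
rewrite -(even_halfK (even_supp bN)) -(even_halfK (even_supp (@kappa_one_form _ _ _))).
rewrite leq_double (leq_trans half_supp_kappa) //.
exact: same_flux_kappa_lower.
Qed.

End Bouquet.

Theorem proposition2p2 (R : realType) :
  (forall (d : nat) (G : periodic_graph R d),
     (d <= form_invariant G)%N /\ (form_invariant G)%:Z <= betti (fund G))
  /\
  (forall (d : nat) (G : periodic_graph R d) (n : int),
     0 <= n <= betti (fund G) ->
     exists alpha : magnetic_potential G, (magnetic_invariant alpha)%:Z = n)
  /\
  (forall M N : nat, (0 < N)%N ->
     exists (d : nat) (G : periodic_graph R d) (alpha : magnetic_potential G),
       betti (fund G) - (form_invariant G)%:Z = M%:Z /\
       betti (fund G) - (magnetic_invariant alpha)%:Z = N%:Z)
  /\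
  (forall K : nat,
     exists (d : nat) (G : periodic_graph R d) (alpha : magnetic_potential G)
            (m : fdart (fund G) -> 'rV[R]_d) (phi : fdart (fund G) -> R^o),
       minimal (same_flux (kappa (G := G))) m /\
       minimal (same_flux_mod2pi (magnetic_form alpha)) phi /\
       betti (fund G) - (joint_invariant m phi)%:Z = K%:Z).
Proof.
split; first by move=> d G; exact: form_invariant_bounds.
split; first by move=> d G n; exact: ex_magnetic_invariant.
split=> [M [//|N] _|K].
  have [alpha alphaE] : exists alpha : magnetic_potential (bouquet_cover R N M),
      (magnetic_invariant alpha)%:Z = M%:Z.
    by apply: ex_magnetic_invariant; rewrite betti_bouquet !lez_nat leq_addl.
  exists N.+1, (bouquet_cover R N M), alpha.
  by rewrite alphaE form_invariant_bouquet betti_bouquet PoszD addrK addrC addKr.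
pose G := bouquet_cover R 0 K.
have zN : one_form (fun _ : fdart (fund G) => 0 : R^o) by move=> e; rewrite oppr0.
exists 1%N, G, (lift_potential zN), (kappa (G := G)), (fun=> 0).
have supp0 : supp (fun _ : fdart (fund G) => 0 : R^o) = finset.set0.
  by apply/setP => e; rewrite !finset.inE eqxx.
have km := kappa_minimal_bouquet R 0 K.
split=> //; split.
  rewrite lift_potentialK; split=> [|b _]; last by rewrite supp0 cards0.
  by split=> // c _; exists 0; rewrite mul0r addr0.
have kI : #|supp (kappa (G := G))|./2 = 1%N.
  apply/eqP; rewrite eqn_leq half_supp_kappa.
  by apply: same_flux_kappa_lower; have [] := km.
by rewrite /joint_invariant supp0 finset.setU0 kI betti_bouquet PoszD addrC addKr.
Qed.
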